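(* Let $f$ be a function satisfying property $P^{*}$, and let $n,k$ be integers with $1\le k\le n-1$. Let $\mathcal{V}_{n}^{k}$ be the set of all connected graphs of order $n$ having a vertex cut set of order $k$. Then for any graph $G\in\mathcal{V}_{n}^{k}$, $$\rho_{f}(G)\le \rho_{f}\bigl(K_{k}\vee (K_{n-1-k}\cup K_1)\bigr),$$ with equality if and only if $G\cong K_{k}\vee (K_{n-1-k}\cup K_1)$.
   Context: All graphs are simple, finite and undirected. $K_m$ is the complete graph on $m$ vertices ($K_0$ is the graph with no vertices). $G_1\cup G_2$ is the disjoint union of graphs, and the join $G_1\vee G_2$ is obtained from $G_1\cup G_2$ by adding all edges between vertices of $G_1$ and vertices of $G_2$. For $W\subseteq V(G)$, $G-W$ is the graph obtained from $G$ by deleting the vertices in $W$. If $G$ is connected, a set $W\subseteq V(G)$ is called a vertex cut set of $G$ if $G-W$ is disconnected or is a single isolated vertex; its order is $|W|$. Weighted adjacency matrix: let $f(x,y)$ be a real-valued symmetric function ($f(x,y)=f(y,x)$) defined for real arguments $x,y\ge 1$. For a graph $G$ with vertices $v_1,\dots,v_n$ of degrees $d_1,\dots,d_n$, $A_f(G)$ is the $n\times n$ matrix whose $(i,j)$ entry is $f(d_i,d_j)$ if $v_i$ is adjacent to $v_j$, and $0$ otherwise. $\rho_f(G)$ denotes the spectral radius of $A_f(G)$ (the weighted spectral radius of $G$). Property $P^{*}$: the symmetric function $f$ satisfies property $P^{*}$ if (i) $f(x,y)>0$ and $f$ is increasing and convex in $x$, meaning $f_x(x,y)\ge 0$ and $f_{xx}(x,y)\ge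 0$ (partial derivatives with respect to $x$, one-sided at the boundary of the domain); and (ii) whenever $x_1+y_1=x_2+y_2$ and $|x_1-y_1|>|x_2-y_2|$, one has $f(x_1,y_1)\ge f(x_2,y_2)$. *)

(* Defs.v *)
From HB Require Import structures.
From mathcomp Require Import all_boot all_order all_algebra.
From mathcomp Require Import complex.
From mathcomp Require Import all_classical all_reals all_analysis.
Set Implicit Arguments.
Unset Strict Implicit.
Unset Printing Implicit Defensive.
Import Order.TTheory GRing.Theory Num.Theory.
Import numFieldNormedType.Exports.

Local Open Scope ring_scope.
Local Open Scope classical_set_scope.

Record sgraph := SGraph {
  vertex :> finType;
  adj : rel vertex;
  adj_sym : symmetric adj;
  adj_irrefl : irreflexive adj
}.

Definition deg (G : sgraph) (x : G) : nat := #|[pred y | adj x y]|.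

(* The graph without vertices satisfies this vacuously. *)
Definition connected_graph (G : sgraph) : Prop :=
  forall x y : G, connect (@adj G) x y.

Definition graph_iso (G H : sgraph) : Prop :=
  exists phi : G -> H,
    bijective phi /\ forall x y : G, adj (phi x) (phi y) = adj x y.

Section Complete.
Variable m : nat.

Definition complete_adj : rel 'I_m := fun i j => i != j.

Fact complete_adj_sym : symmetric complete_adj.
Proof. by move=> i j; rewrite /complete_adj eq_sym. Qed.

Fact complete_adj_irrefl : irreflexive complete_adj.
Proof. by move=> i; rewrite /complete_adj eqxx. Qed.

Definition complete_graph : sgraph := SGraph complete_adj_sym complete_adj_irrefl.
End Complete.

Section UnionJoin.
Variables G H : sgraph.

(* [b] tells whether vertices of [G] are adjacent to those of [H]. *)
Definition sum_adj (b : bool) : rel (G + H)%type := fun u v =>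
  match u, v with
  | inl x, inl y => adj x y
  | inr x, inr y => adj x y
  | _, _ => b
  end.

Fact sum_adj_sym b : symmetric (sum_adj b).
Proof. by move=> [x|x] [y|y] //=; rewrite adj_sym. Qed.

Fact sum_adj_irrefl b : irreflexive (sum_adj b).
Proof. by move=> [x|x] /=; rewrite adj_irrefl. Qed.

Definition graph_union : sgraph :=
  SGraph (sum_adj_sym false) (sum_adj_irrefl false).

Definition graph_join : sgraph :=
  SGraph (sum_adj_sym true) (sum_adj_irrefl true).
End UnionJoin.

Section Delete.
Variables (G : sgraph) (W : {set G}).

Definition delete_adj : rel {x : G | x \notin W} :=
  fun x y => adj (val x) (val y).

Fact delete_adj_sym : symmetric delete_adj.
Proof. by move=> x y; apply: adj_sym. Qed.

Fact delete_adj_irrefl : irreflexive delete_adj.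
Proof. by move=> x; apply: adj_irrefl. Qed.

Definition delete_vertices : sgraph := SGraph delete_adj_sym delete_adj_irrefl.
End Delete.

Definition vertex_cut_set (G : sgraph) (W : {set G}) : Prop :=
  ~ connected_graph (delete_vertices W) \/ #|delete_vertices W| = 1%N.

Definition connected_with_cut (n k : nat) (G : sgraph) : Prop :=
  [/\ connected_graph G, #|G| = n &
      exists2 W : {set G}, vertex_cut_set W & #|W| = k].

Definition weighted_adjacency (R : realType) (f : R -> R -> R) (G : sgraph) :
    'M[R]_#|G| :=
  \matrix_(i, j) if adj (enum_val i) (enum_val j)
                 then f (deg (enum_val i))%:R (deg (enum_val j))%:R else 0.

Definition spectral_radius (R : realType) (n : nat) (A : 'M[R]_n) : R :=
  sup [set ComplexField.Normc.normc z | z in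
         [set z : complex R | eigenvalue (map_mx (real_complex R) A) z]].

Definition weighted_radius (R : realType) (f : R -> R -> R) (G : sgraph) : R :=
  spectral_radius (weighted_adjacency f G).

(* Derivative at [x] of [g] restricted to [1, +oo[: two-sided for [1 < x] and
   one-sided for [x = 1]. *)
Definition has_derivative_ge1 (R : realType) (g : R -> R) (x l : R) : Prop :=
  (g t - g x) / (t - x) @[t --> within [set t | 1 <= t] x^'] --> l.

(* Only the values of [f] on [1, +oo[ x [1, +oo[ are constrained; [fx] and
   [fxx] are the first and second partial derivatives of [f] in its first
   argument. *)
Definition property_Pstar (R : realType) (f : R -> R -> R) : Prop :=
  [/\ forall x y, 1 <= x -> 1 <= y -> 0 < f x y,
      exists fx fxx : R -> R -> R, forall x y, 1 <= x -> 1 <= y ->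
        [/\ has_derivative_ge1 (f ^~ y) x (fx x y),
            has_derivative_ge1 (fx ^~ y) x (fxx x y),
            0 <= fx x y & 0 <= fxx x y] &
      forall x1 y1 x2 y2,
        1 <= x1 -> 1 <= y1 -> 1 <= x2 -> 1 <= y2 ->
        x1 + y1 = x2 + y2 -> `|x2 - y2| < `|x1 - y1| -> f x2 y2 <= f x1 y1].

(* Main.v *)
(* A positive vector [u] with [A u <= rho u] bounds the modulus of every
   eigenvalue of a nonnegative matrix [A] by [rho]; for a connected graph the
   bound is strict as soon as one row is strict, and [rho] is attained when all
   rows are equalities. So it suffices to exhibit test vectors.

   Let [rho] be the Perron root of [K_k \/ (K_m \cup K_1)], where m = n-1-k. A
   graph [G] with a cut set of order [k] is a spanning subgraph of some
   [K_k \/ (K_a \cup K_b)] with a + b = m + 1. The vector constant on the three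
   classes that solves the rows of [K_a] and [K_b] for [rho] leaves in the rows
   of [K_k] an excess controlled by [g a + g b <= g m + g 1], where, with
   d = k + c - 1,
     g c = c f(n-1, d)^2 / (rho - (c-1) f(d, d)).
   The inequality is strict for a, b >= 2: replacing f(d, d) by its largest value
   turns [g] into a product of increasing functions that are superadditive up to
   their value at c = 1. When b = 1, strictness comes from a missing edge. *)
Require Import Defs.
From mathcomp Require Import all_boot all_order all_algebra.
From mathcomp Require Import complex zify ring lra.
From mathcomp Require Import all_classical all_reals all_analysis.
Import Order.TTheory GRing.Theory Num.Theory.
Import numFieldNormedType.Exports.
Local Open Scope classical_set_scope.
Local Open Scope ring_scope.
Set Implicit Arguments.
Unset Strict Implicit.
Unset Printing Implicit Defensive.

(** * Test vectors and the weighted spectral radius *)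

Section Supersolution.
Variables (R : realType) (T : finType) (w : T -> T -> R) (u h : T -> R).
Variables (rho la : R).
Hypothesis w_ge0 : forall x y, 0 <= w x y.
Hypothesis u_gt0 : forall x, 0 < u x.
Hypothesis u_super : forall x, \sum_y w x y * u y <= rho * u x.
Hypothesis h_sub : forall x, la * h x <= \sum_y w x y * h y.

(* The vertices maximizing [h x / u x] satisfy the equality, and for [la = rho]
   their neighbours are maximizers too. *)
Lemma subsolution_le x0 : 0 < h x0 ->
  la <= rho /\
  (la = rho -> forall e : rel T, (forall x y, connect e x y) ->
     (forall x y, e x y -> 0 < w x y) ->
     forall x, \sum_y w x y * u y = rho * u x).
Proof.
move=> hx0.
case: (@arg_maxP _ R T x0 predT (fun x => h x / u x) isT) => i _ imax.
set M := h i / u i in imax.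
have M_gt0 : 0 < M.
  by apply: lt_le_trans (imax x0 isT); rewrite divr_gt0.
have hM j : h j <= M * u j by rewrite -ler_pdivrMr //; apply: imax.
have sum_le x : \sum_y w x y * h y <= M * \sum_y w x y * u y.
  rewrite mulr_sumr; apply: ler_sum => y _.
  by rewrite mulrCA; apply: ler_wpM2l.
have hi : h i = M * u i by rewrite /M divfK // gt_eqF.
have chain x : h x = M * u x -> la * (M * u x) <= M * (\sum_y w x y * u y).
  by move=> hx; rewrite -hx; apply: le_trans (h_sub x) (sum_le x).
split.
  have := chain i hi; rewrite mulrCA ler_pM2l // => Hi.
  by have := le_trans Hi (u_super i); rewrite ler_pM2r.
move=> eq_rho e conn e_w.
have eq_at x : h x = M * u x -> \sum_y w x y * u y = rho * u x.
  move=> hx; apply/eqP; rewrite eq_le u_super /=.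
  by have := chain x hx; rewrite mulrCA ler_pM2l // eq_rho.
have step x y : h x = M * u x -> e x y -> h y = M * u y.
  move=> hx exy.
  (* All terms are nonnegative, so a zero sum makes [h z = M * u z] wherever [w x z > 0]. *)
  have S0 : \sum_z w x z * (M * u z - h z) = 0.
    apply/eqP; rewrite eq_le sumr_ge0 ?andbT; last first.
      by move=> z _; rewrite mulr_ge0 // subr_ge0.
    under eq_bigr do rewrite mulrBr mulrCA.
    rewrite sumrB -mulr_sumr eq_at // subr_le0 mulrCA -hx -eq_rho.
    exact: h_sub.
  have nng z : predT z -> 0 <= w x z * (M * u z - h z).
    by move=> _; rewrite mulr_ge0 // subr_ge0.
  have /eqP := psumr_eq0P nng S0 (isT : predT y).
  by rewrite mulf_eq0 gt_eqF ?e_w //= subr_eq0 => /eqP.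
move=> x; apply: eq_at.
have /connectP[p pth ->] := conn i x.
elim: p {x} (i) hi pth => //= y p IHp z hz /andP[ezy pth].
by apply: IHp => //; apply: step ezy.
Qed.

End Supersolution.

(** Strict bounds need not survive a supremum; over a finite list they leave a uniform gap. [0 <= M]
    also covers the empty set, whose [sup] is 0. *)
Lemma seq_strict_bound (R : realType) (T : eqType) (s : seq T) (S : T -> Prop)
    (F : T -> R) (rho : R) :
  0 < rho -> (forall z, S z -> F z < rho) ->
  exists M, [/\ 0 <= M, M < rho & forall z, z \in s -> S z -> F z <= M].
Proof.
move=> rho_gt0 lt_rho.
elim: s => [|z s [M [M_ge0 M_lt Mub]]]; first by exists 0; split.
have [Sz|nz] := pselect (S z); last first.
  by exists M; split=> // z'; rewrite in_cons => /predU1P[-> /nz|] //; apply: Mub.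
exists (Num.max M (F z)); split; first by rewrite le_max M_ge0.
  by rewrite gt_max M_lt lt_rho.
move=> z'; rewrite in_cons le_max => /predU1P[-> _|]; first by rewrite lexx orbT.
by move=> z's Sz'; rewrite Mub.
Qed.

(** * Eigenvalues of the weighted adjacency matrix *)

Section Radius.
Variables (R : realType) (f : R -> R -> R).
Hypothesis f_sym : forall x y : R, 1 <= x -> 1 <= y -> f x y = f y x.
Hypothesis f_gt0 : forall x y : R, 1 <= x -> 1 <= y -> 0 < f x y.

Definition weight (G : sgraph) (x y : G) : R :=
  if adj x y then f (deg x)%:R (deg y)%:R else 0.

Lemma adj_deg (G : sgraph) (x y : G) : adj x y -> (0 < deg x)%N.
Proof. by move=> xy; apply/card_gt0P; exists y. Qed.

Lemma weight_gt0 (G : sgraph) (x y : G) : adj x y -> 0 < weight x y.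
Proof.
move=> xy; rewrite /weight xy f_gt0 // ler1n; first exact: adj_deg xy.
by apply: (@adj_deg _ y x); rewrite adj_sym.
Qed.

Lemma weight_ge0 (G : sgraph) (x y : G) : 0 <= weight x y.
Proof.
case: (boolP (adj x y)) => [/weight_gt0/ltW //|nxy].
by rewrite /weight (negPf nxy).
Qed.

Lemma weight_sym (G : sgraph) (x y : G) : weight x y = weight y x.
Proof.
rewrite /weight adj_sym; case: ifP => // yx.
apply: f_sym; rewrite ler1n; last exact: adj_deg yx.
by apply: (@adj_deg _ x y); rewrite adj_sym.
Qed.

Lemma sum_enum_val (V : nmodType) (T : finType) (F : 'I_#|T| -> V) :
  \sum_i F i = \sum_x F (enum_rank x).
Proof.
by rewrite (reindex_onto (@enum_rank T) enum_val) /=;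
  [apply: eq_bigl => x; rewrite enum_rankK eqxx
  |move=> i _; rewrite enum_valK].
Qed.

Lemma normc_ge0 (z : complex R) : 0 <= ComplexField.Normc.normc z.
Proof. by case: z => a b; apply: sqrtr_ge0. Qed.

Lemma normc_real (r : R) : 0 <= r -> ComplexField.Normc.normc r%:C%C = r.
Proof. by move=> r0; rewrite /= expr0n addr0 sqrtr_sqr ger0_norm. Qed.

Lemma ler_normc_sum (T : finType) (F : T -> complex R) :
  ComplexField.Normc.normc (\sum_x F x) <=
  \sum_x ComplexField.Normc.normc (F x).
Proof.
elim/big_ind2: _ => // [|a b c d ab cd]; first by rewrite ComplexField.Normc.normc0.
by apply: le_trans (le_normcD _ _) _; apply: lerD.
Qed.

Let normc := @ComplexField.Normc.normc R.
Let spectrum (G : sgraph) (z : complex R) : Prop :=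
  eigenvalue (map_mx (real_complex R) (weighted_adjacency f G)) z.

(** Take the moduli of the entries of an eigenvector and apply the triangle inequality. Eigenvectors
    are row vectors, so the symmetry of [weight] is needed to return to sums along rows. *)
Lemma spectrum_subsolution (G : sgraph) z : @spectrum G z ->
  exists2 h : G -> R, (exists x, 0 < h x) &
    forall x, normc z * h x <= \sum_y weight x y * h y.
Proof.
move=> /eigenvalueP[v vA v0].
exists (fun x => normc (v ord0 (enum_rank x))).
  have /rV0Pn[i vi] := v0.
  exists (enum_val i); rewrite enum_valK lt_def.
  rewrite normc_ge0 andbT.
  by apply: contra vi => /eqP/ComplexField.Normc.eq0_normc->.
move=> x.
have := congr1 (fun m : 'rV__ => m ord0 (enum_rank x)) vA; rewrite !mxE => eqx.
rewrite -[leLHS]ComplexField.Normc.normcM -eqx sum_enum_val.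
apply: le_trans (ler_normc_sum _) _.
apply: ler_sum => y _.
rewrite ComplexField.Normc.normcM !mxE !enum_rankK -/(weight y x).
by rewrite [weight x y]weight_sym mulrC normc_real ?weight_ge0.
Qed.

Lemma spectrum_finite (G : sgraph) : exists s : seq (complex R),
  forall z, @spectrum G z -> z \in s.
Proof.
set A := map_mx (real_complex R) (weighted_adjacency f G).
have [s eq_s] := closed_field_poly_normal (char_poly A).
exists s => z; rewrite /spectrum eigenvalue_root_char eq_s rootZ ?root_prod_XsubC //.
by rewrite lead_coef_eq0 monic_neq0 // char_poly_monic.
Qed.

Variables (G : sgraph) (u : G -> R) (rho : R).
Hypothesis u_gt0 : forall x, 0 < u x.
Hypothesis rho_gt0 : 0 < rho.

(** An eigenvalue of modulus [rho] would force equality in every row by [subsolution_le], against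
    the strict row. Finiteness of the spectrum carries strictness over to the supremum. *)
Lemma weighted_radius_lt :
    connected_graph G ->
    (forall x, \sum_y weight x y * u y <= rho * u x) ->
    (exists x, \sum_y weight x y * u y < rho * u x) ->
  weighted_radius f G < rho.
Proof.
move=> conn super [x0 strict].
have lt_rho z : @spectrum G z -> normc z < rho.
  move=> /spectrum_subsolution[h [x hx] hsub].
  have [le_rho eq_rho] := subsolution_le (@weight_ge0 G) u_gt0 super hsub hx.
  rewrite lt_neqAle le_rho andbT; apply/eqP => /eq_rho/(_ _ conn).
  by move=> /(_ (@weight_gt0 G))/(_ x0) eq0; rewrite eq0 ltxx in strict.
have [s spec_s] := spectrum_finite G.
have [M [M_ge0 M_lt Mub]] := seq_strict_bound s rho_gt0 lt_rho.
apply: le_lt_trans M_lt; rewrite /weighted_radius /spectral_radius.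
set S := (X in sup X).
have [->|/set0P S0] := eqVneq S set0; first by rewrite sup0.
apply: ge_sup => // _ [z sz <-].
by apply: Mub => //; apply: spec_s.
Qed.

(** The vector [u] is itself an eigenvector, so [rho] is among the moduli; [subsolution_le] makes it
    an upper bound. *)
Lemma weighted_radius_eq :
    (0 < #|G|)%N -> (forall x, \sum_y weight x y * u y = rho * u x) ->
  weighted_radius f G = rho.
Proof.
move=> /card_gt0P[x0 _] eig.
have le_rho z : @spectrum G z -> normc z <= rho.
  move=> /spectrum_subsolution[h [x hx] hsub].
  have super x' : \sum_y weight x' y * u y <= rho * u x' by rewrite eig.
  by have [] := subsolution_le (@weight_ge0 G) u_gt0 super hsub hx.
rewrite /weighted_radius /spectral_radius; set S := (X in sup X).
have Srho : S rho.
  exists rho%:C%C.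
    apply/eigenvalueP; exists (\row_i (u (enum_val i))%:C%C).
      apply/rowP => j; rewrite !mxE -rmorphM -eig rmorph_sum sum_enum_val.
      apply: eq_bigr => y _; rewrite !mxE enum_rankK -rmorphM mulrC.
      by rewrite -/(weight y (enum_val j)) weight_sym.
    apply/rV0Pn; exists (enum_rank x0); rewrite mxE enum_rankK.
    by rewrite fmorph_eq0 gt_eqF.
  exact: normc_real (ltW rho_gt0).
apply/eqP; rewrite eq_le; apply/andP; split.
  by apply: ge_sup; [exists rho|move=> _ [z sz <-]; apply: le_rho].
apply: ub_le_sup Srho.
by exists rho => _ [z sz <-]; apply: le_rho.
Qed.

End Radius.

(** * Convexity *)

Section RightDerivative.
Variables (R : realType).
Implicit Types g : R -> R.

Lemma derivative_ge1_is_derive g (x l : R) :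
  1 < x -> has_derivative_ge1 g x l -> is_derive x 1 g l.
Proof.
move=> x1 gl.
have cvg_l : (fun h => h^-1 *: ((g \o shift x) (h *: 1) - g x)) @ 0^' --> l.
  apply/cvgrPdist_lt => e e0; move/cvgrPdist_lt/(_ e e0): gl.
  rewrite near_withinE near_withinE => /nbhs_ballP[d /= d0 hd].
  rewrite near_withinE; apply/nbhs_ballP.
  (* A radius of at most [x - 1] keeps [h + x] above 1, inside the domain of the restricted
     limit. *)
  exists (Num.min d (x - 1)) => [|h]; rewrite /= ?lt_min ?d0 ?subr_gt0 //.
  rewrite /ball /= sub0r normrN lt_min => /andP[hd1 hd2] h0.
  have := hd (h + x); rewrite /ball /= opprD addrCA subrr addr0 normrN addrK.
  rewrite [h *: 1]mulr1 [h^-1 *: _]mulrC; apply=> //.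
    by rewrite -subr_eq0 addrK.
  by move: hd2; rewrite ltr_norml => /andP[]; lra.
by apply: DeriveDef; [apply/cvg_ex; exists l|apply: cvg_lim].
Qed.

(** Near [x] the difference quotients are bounded by [|g' x| + 1], a Lipschitz estimate at [x] that
    holds at the endpoint 1 too. *)
Lemma derivative_ge1_continuous g (a b : R) g' : 1 <= a ->
  (forall x, 1 <= x -> has_derivative_ge1 g x (g' x)) ->
  {within `[a, b], continuous g}.
Proof.
move=> a1 dg; apply/subspace_continuousP => x; rewrite /= in_itv /= => /andP[ax _].
have x1 : 1 <= x by apply: le_trans ax.
apply/cvgrPdist_lt => e e0; have := dg x x1.
move/cvgrPdist_lt/(_ 1 ltr01).
rewrite near_withinE near_withinE => /nbhs_ballP[d /= d0 hd].
rewrite /prop_near1 /within /=; apply/nbhs_ballP.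
have K0 : 0 < `|g' x| + 1 by apply: ltr_wpDl.
exists (Num.min d (e / (`|g' x| + 1))) => [|t]; rewrite /= ?lt_min ?d0 ?divr_gt0 //.
rewrite /ball /= lt_min => /andP[td te]; rewrite in_itv /= => /andP[at_ _].
have [->|tx] := eqVneq t x; first by rewrite subrr normr0.
have tx0 : t - x != 0 by rewrite subr_eq0.
have := hd t td tx (le_trans a1 at_) => h.
have {}h : `|(g t - g x) / (t - x)| < `|g' x| + 1.
  rewrite -ltrBlDl; apply: le_lt_trans h.
  by rewrite distrC; apply: lerB_dist.
rewrite distrC -[g t - g x](divfK tx0) normrM.
apply: (@lt_trans _ _ ((`|g' x| + 1) * `|t - x|)).
  by rewrite ltr_pM2r ?normr_gt0.
by rewrite mulrC -ltr_pdivlMr // distrC.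
Qed.

Lemma derivative_ge1_MVT g g' (a b : R) : 1 <= a -> a < b ->
  (forall x, 1 <= x -> has_derivative_ge1 g x (g' x)) ->
  exists2 c, a < c < b & g b - g a = g' c * (b - a).
Proof.
move=> a1 ab dg.
have [||c] := @MVT R g g' a b ab; last first.
- by rewrite in_itv /= => cab ->; exists c.
- exact: derivative_ge1_continuous dg.
move=> x; rewrite in_itv /= => /andP[ax _].
apply: derivative_ge1_is_derive (dg _ _); first exact: le_lt_trans ax.
by rewrite ltW // (le_lt_trans a1).
Qed.

Lemma derivative_ge1_ge0_le g g' (a b : R) : 1 <= a -> a <= b ->
  (forall x, 1 <= x -> has_derivative_ge1 g x (g' x)) ->
  (forall x, 1 <= x -> 0 <= g' x) -> g a <= g b.
Proof.
move=> a1; rewrite le_eqVlt => /orP[/eqP->//|ab] dg g'0.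
have [c /andP[ac cb] eqg] := derivative_ge1_MVT a1 ab dg.
rewrite -subr_ge0 eqg; apply: mulr_ge0; last by rewrite subr_ge0 ltW.
by apply: g'0; rewrite ltW // (le_lt_trans a1).
Qed.

(** For [p <= q], apply the mean value theorem on [[s, s + p]] and [[s + q, s + p + q]]: both have
    length [p], the second lies to the right of the first, and [g'] is nondecreasing. *)
Lemma derivative_ge1_convex g g' g'' (s p q : R) : 1 <= s -> 0 < p -> 0 < q ->
  (forall x, 1 <= x -> has_derivative_ge1 g x (g' x)) ->
  (forall x, 1 <= x -> has_derivative_ge1 g' x (g'' x)) ->
  (forall x, 1 <= x -> 0 <= g'' x) ->
  g (s + p) + g (s + q) <= g (s + p + q) + g s.
Proof.
move=> s1 + + dg dg' g''0.
wlog pq : p q / p <= q => [hwlog p0 q0|p0 q0].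
  have [pq|/ltW qp] := lerP p q; first exact: hwlog.
  by rewrite addrC (addrAC s); apply: hwlog.
have [c1 /andP[c1a c1b] e1] : exists2 c, s < c < s + p &
    g (s + p) - g s = g' c * (s + p - s).
  by apply: derivative_ge1_MVT => //; rewrite ltrDl.
have [c2 /andP[c2a c2b] e2] : exists2 c, s + q < c < s + p + q &
    g (s + p + q) - g (s + q) = g' c * (s + p + q - (s + q)).
  by apply: derivative_ge1_MVT => //; lra.
have : g' c1 <= g' c2 by apply: derivative_ge1_ge0_le dg' g''0; lra.
move=> /(ler_wpM2r (ltW p0)).
have -> : g' c1 * p = g (s + p) - g s by rewrite e1; ring.
have -> : g' c2 * p = g (s + p + q) - g (s + q) by rewrite e2; ring.
lra.
Qed.

End RightDerivative.

(** * Four-point inequalities and the Perron root *)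

Section FourPoints.
Variable R : realType.

(* [a0], [ax], [ay], [az] are the values of the first factor at the points [0],
   [x], [y] and [x + y], and similarly for [b]. *)
Lemma four_point_mul (a0 ax ay az b0 bx by_ bz : R) :
  0 <= a0 -> 0 <= b0 -> a0 <= ax -> a0 <= ay -> b0 <= bx -> b0 <= by_ ->
  ax + ay <= az + a0 -> bx + by_ <= bz + b0 ->
  ax * bx + ay * by_ + (ax - a0) * (by_ - b0) + (ay - a0) * (bx - b0) <=
  az * bz + a0 * b0.
Proof.
move=> a00 b00 hax hay hbx hby ha hb.
set p := ax - a0; set q := ay - a0; set r := az - a0.
set p' := bx - b0; set q' := by_ - b0; set r' := bz - b0.
have H1 : 0 <= a0 * (r' - p' - q') by apply: mulr_ge0; rewrite /r' /p' /q' //; lra.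
have H2 : 0 <= b0 * (r - p - q) by apply: mulr_ge0; rewrite /r /p /q //; lra.
(* The product of the two superadditivity hypotheses. Its cross terms are kept in the conclusion, as
   a later source of strictness. *)
have H3 : (p + q) * (p' + q') <= r * r'.
  by apply: ler_pM; rewrite /r /p /q /r' /p' /q'; lra.
rewrite -subr_ge0.
have -> : az * bz + a0 * b0 - (ax * bx + ay * by_ + p * q' + q * p') =
  a0 * (r' - p' - q') + b0 * (r - p - q) + (r * r' - (p + q) * (p' + q')).
  by rewrite /r /p /q /r' /p' /q'; ring.
by apply: addr_ge0; [apply: addr_ge0|rewrite subr_ge0].
Qed.

(** With [X], [Y], [Z] as below, [X + Y = Z + rho], so both sides are fractions with this numerator;
    the denominators differ by [X * Y - Z * rho = (s * L) * (t * L)]. *)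
Lemma four_point_inv (rho L s t : R) : 0 <= L -> 0 <= s -> 0 <= t ->
  (s + t) * L < rho ->
  (rho - s * L)^-1 + (rho - t * L)^-1 <= (rho - (s + t) * L)^-1 + rho^-1.
Proof.
move=> L0 s0 t0 lt_rho.
have sL : 0 <= s * L by apply: mulr_ge0.
have tL : 0 <= t * L by apply: mulr_ge0.
rewrite mulrDl in lt_rho *.
set X := rho - s * L; set Y := rho - t * L; set Z := rho - (s * L + t * L).
have X0 : 0 < X by rewrite /X; lra.
have Y0 : 0 < Y by rewrite /Y; lra.
have Z0 : 0 < Z by rewrite /Z; lra.
have r0 : 0 < rho by lra.
have -> : X^-1 + Y^-1 = (Z + rho) / (X * Y).
  have -> : Z + rho = X + Y by rewrite /X /Y /Z; ring.
  by field; rewrite !gt_eqF.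
have -> : Z^-1 + rho^-1 = (Z + rho) / (Z * rho) by field; rewrite !gt_eqF.
apply: ler_wpM2l; first by rewrite addr_ge0 ?ltW.
rewrite lef_pV2 ?posrE ?mulr_gt0 //.
rewrite -subr_ge0.
have -> : X * Y - Z * rho = (s * L) * (t * L) by rewrite /X /Y /Z; ring.
exact: mulr_ge0.
Qed.

(* The inequality [g a + g b < g m + g 1], with [s = a - 1] and [t = b - 1]. *)
Lemma clique_contribution_lt (rho p1 pa pb pm qa qb L s t : R) :
  0 < s -> 0 < t -> 0 < p1 -> p1 <= pa -> p1 <= pb -> pa + pb <= pm + p1 ->
  0 < L -> qa <= L -> qb <= L -> (s + t) * L < rho ->
  (s + 1) * pa ^+ 2 / (rho - s * qa) + (t + 1) * pb ^+ 2 / (rho - t * qb) <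
  (s + t + 1) * pm ^+ 2 / (rho - (s + t) * L) + p1 ^+ 2 / rho.
Proof.
move=> s0 t0 p10 p1a p1b pab L0 qaL qbL lt_rho.
have sL : 0 < s * L by apply: mulr_gt0.
have tL : 0 < t * L by apply: mulr_gt0.
have r0 : 0 < rho by rewrite mulrDl in lt_rho; lra.
have Z0 : 0 < rho - (s + t) * L by rewrite subr_gt0.
have X0 : 0 < rho - s * L by rewrite mulrDl in lt_rho; lra.
have Y0 : 0 < rho - t * L by rewrite mulrDl in lt_rho; lra.
have pa0 : 0 < pa by apply: lt_le_trans p1a.
have pb0 : 0 < pb by apply: lt_le_trans p1b.
have sqa : s * qa <= s * L by rewrite ler_pM2l.
have tqb : t * qb <= t * L by rewrite ler_pM2l.
have ha : (s + 1) * pa ^+ 2 / (rho - s * qa) <=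
    (s + 1) * (pa * pa * (rho - s * L)^-1).
  rewrite mulrA -expr2 ler_wpM2l //; first by rewrite mulr_ge0 ?sqr_ge0 //; lra.
  by rewrite lef_pV2 ?posrE; lra.
have hb : (t + 1) * pb ^+ 2 / (rho - t * qb) <=
    (t + 1) * (pb * pb * (rho - t * L)^-1).
  rewrite mulrA -expr2 ler_wpM2l //; first by rewrite mulr_ge0 ?sqr_ge0 //; lra.
  by rewrite lef_pV2 ?posrE; lra.
(* Three uses of [four_point_mul] build up the terms: first the squares, then the inverses, then the
   clique sizes. *)
have := four_point_mul (ltW p10) (ltW p10) p1a p1b p1a p1b pab pab.
set A := (pa - p1) * _; set B := (pb - p1) * _.
have A0 : 0 <= A by rewrite mulr_ge0 // subr_ge0.
have B0 : 0 <= B by rewrite mulr_ge0 // subr_ge0.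
move=> h1.
have h1' : pa * pa + pb * pb <= pm * pm + p1 * p1 by lra.
have h2 := four_point_inv (ltW L0) (ltW s0) (ltW t0) lt_rho.
have p11a : p1 * p1 <= pa * pa by apply: ler_pM => //; apply: ltW.
have p11b : p1 * p1 <= pb * pb by apply: ler_pM => //; apply: ltW.
have p110 : 0 < p1 * p1 by apply: mulr_gt0.
have iX : rho^-1 < (rho - s * L)^-1 by rewrite ltf_pV2 ?posrE //; lra.
have iY : rho^-1 < (rho - t * L)^-1 by rewrite ltf_pV2 ?posrE //; lra.
have i0 : 0 < rho^-1 by rewrite invr_gt0.
have := four_point_mul (ltW p110) (ltW i0) p11a p11b (ltW iX) (ltW iY) h1' h2.
have A0' : 0 <= (pa * pa - p1 * p1) * ((rho - t * L)^-1 - rho^-1).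
  by rewrite mulr_ge0 // subr_ge0 // ltW.
have B0' : 0 <= (pb * pb - p1 * p1) * ((rho - s * L)^-1 - rho^-1).
  by rewrite mulr_ge0 // subr_ge0 // ltW.
move=> h3.
set ga := pa * pa * (rho - s * L)^-1 in ha h3 *.
set gb := pb * pb * (rho - t * L)^-1 in hb h3 *.
have h3' : ga + gb <= pm * pm * (rho - (s + t) * L)^-1 + p1 * p1 * rho^-1 by lra.
have ga1 : p1 * p1 * rho^-1 < ga.
  apply: lt_le_trans (_ : p1 * p1 * (rho - s * L)^-1 <= _).
    by rewrite ltr_pM2l.
  by rewrite ler_wpM2r // invr_ge0 ltW.
have gb1 : p1 * p1 * rho^-1 < gb.
  apply: lt_le_trans (_ : p1 * p1 * (rho - t * L)^-1 <= _).
    by rewrite ltr_pM2l.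
  by rewrite ler_wpM2r // invr_ge0 ltW.
have g10 : 0 < p1 * p1 * rho^-1 by apply: mulr_gt0.
have s11 : 1 <= s + 1 by lra.
have t11 : 1 <= t + 1 by lra.
have st : s + 1 + (t + 1) <= s + t + 1 + 1 by lra.
have := four_point_mul ler01 (ltW g10) s11 t11 (ltW ga1) (ltW gb1) st h3'.
(* Strictness comes from the cross terms of the last product: [s] and [t] times positive
   differences. *)
have strict : 0 < (s + 1 - 1) * (gb - p1 * p1 / rho).
  by rewrite addrK mulr_gt0 // subr_gt0.
have weak : 0 < (t + 1 - 1) * (ga - p1 * p1 / rho).
  by rewrite addrK mulr_gt0 // subr_gt0.
rewrite !expr2 mulrA mul1r; lra.
Qed.

(* For [K_k \/ (K_m \cup K_1)], [m = 0] corresponds to [alpha = L = 0]. *)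
Lemma perron_root (c L alpha beta : R) :
  0 <= c -> 0 <= L -> 0 <= alpha -> 0 < beta -> (L = 0 \/ 0 < alpha) ->
  exists rho, [/\ 0 < rho, L < rho & rho = c + (alpha / (rho - L) + beta / rho)].
Proof.
move=> c0 L0 a0 b0 La.
(* The equation for [rho], multiplied by [(rho - L) * rho]. *)
pose P : {poly R} := ('X - c%:P) * ('X - L%:P) * 'X
   - (alpha%:P * 'X + beta%:P * ('X - L%:P)).
have PE x : P.[x] = (x - c) * (x - L) * x - (alpha * x + beta * (x - L)).
  by rewrite /P !hornerE.
(* This makes [P] nonpositive at [L + d]. Starting to the right of [L] keeps the root away from the
   pole [L], which is itself a root of [P] when [L = 0]. *)
have [d [d0 d1 dP]] : exists d, [/\ 0 < d, d <= 1 &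
    d * (L + d) * (L + d) <= alpha * (L + d) + beta * d].
  case: La => [->|a_gt0].
    exists (Num.min 1 beta); rewrite lt_min ltr01 b0 ge_min lexx; split=> //.
    set d := Num.min _ _.
    have d0 : 0 < d by rewrite /d lt_min ltr01 b0.
    have db : d <= beta by rewrite /d ge_min lexx orbT.
    have d1 : d <= 1 by rewrite /d ge_min lexx.
    rewrite !add0r -mulrDl ler_pM2r //.
    have : d * d <= d by rewrite ger_pMl.
    lra.
  exists (Num.min 1 (alpha / (L + 1))).
  have L1 : 0 < L + 1 by lra.
  have aL : 0 < alpha / (L + 1) by rewrite divr_gt0.
  rewrite lt_min ltr01 aL ge_min lexx; split=> //.
  set d := Num.min _ _.
  have d0 : 0 < d by rewrite /d lt_min ltr01 aL.
  have d1 : d <= 1 by rewrite /d ge_min lexx.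
  have da : d * (L + 1) <= alpha by rewrite -ler_pdivlMr // /d ge_min lexx orbT.
  have dL : d * (L + d) <= alpha.
    by apply: le_trans da; rewrite ler_pM2l //; lra.
  have bd : 0 < beta * d by rewrite mulr_gt0.
  have : d * (L + d) * (L + d) <= alpha * (L + d) by rewrite ler_wpM2r //; lra.
  lra.
(* Large enough for [hi - c >= alpha + beta] and [hi - L >= 1]. *)
pose hi := L + c + alpha + beta + 1.
have [rho /andP[lo_rho rho_hi] /rootP] : exists2 x, L + d <= x <= hi & root P x.
  apply: poly_ivt; first by rewrite /hi; lra.
  rewrite !PE; apply/andP; split.
    have : 0 <= c * d * (L + d) by rewrite !mulr_ge0 //; lra.
    move: dP; lra.
  have hi0 : 0 < hi by rewrite /hi; lra.
  have low : alpha * hi + beta * (hi - L) <= (alpha + beta) * hi.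
    by rewrite mulrDl lerD2l ler_wpM2l //; lra.
  have high : (alpha + beta) * 1 <= (hi - c) * (hi - L).
    by apply: ler_pM; rewrite /hi; lra.
  rewrite subr_ge0; apply: le_trans low _.
  by rewrite ler_pM2r //; lra.
rewrite PE => root_rho.
have rL : 0 < rho - L by lra.
have r0 : 0 < rho by lra.
exists rho; split=> //; first lra.
apply/eqP; rewrite -subr_eq0; apply/eqP.
have -> : rho - (c + (alpha / (rho - L) + beta / rho)) =
  ((rho - c) * (rho - L) * rho - (alpha * rho + beta * (rho - L))) /
  ((rho - L) * rho).
  by field; rewrite !gt_eqF.
by rewrite root_rho mul0r.
Qed.

End FourPoints.

(** * Graphs with a vertex cut *)

(* Class [None] is the [K_k] of [K_k \/ (K_a \cup K_b)], and [Some true] and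
   [Some false] are [K_a] and [K_b]. *)
Section SplitGraph.
Variables (V : finType) (c : V -> option bool).

Definition compatible (o o' : option bool) : bool :=
  match o, o' with Some p, Some q => p == q | _, _ => true end.

Definition split_adj : rel V := fun x y => (x != y) && compatible (c x) (c y).

Fact split_adj_sym : symmetric split_adj.
Proof.
move=> x y; rewrite /split_adj eq_sym.
by case: (c x) (c y) => [[]|] [[]|].
Qed.

Fact split_adj_irrefl : irreflexive split_adj.
Proof. by move=> x; rewrite /split_adj eqxx. Qed.

Definition split_graph : sgraph := SGraph split_adj_sym split_adj_irrefl.

Definition class_size (o : option bool) : nat := #|[pred x | c x == o]|.

(** The subtraction removes the vertex itself from the count of its own class. *)
Definition class_degree (o : option bool) : nat :=
  (\sum_(o' | compatible o o') (class_size o' - (o' == o)))%N.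

(** Group the neighbours of [x] by class: all of each compatible class, except [x] itself. This
    serves for degrees, with [g] constant, and for the rows of the matrix. *)
Lemma sum_split_adj (M : nmodType) (x : V) (g : option bool -> M) :
  \sum_(y | split_adj x y) g (c y) =
  \sum_(o | compatible (c x) o) g o *+ (class_size o - (o == c x)).
Proof.
rewrite (partition_big c (compatible (c x))) /=; last by move=> y /andP[].
apply: eq_bigr => o xo.
rewrite (eq_bigr (fun=> g o)); last by move=> y /andP[_ /eqP->].
rewrite sumr_const; congr (_ *+ _).
rewrite /class_size [X in (X - _)%N](cardD1 x) inE (eq_sym o) addKn.
apply: eq_card => y; rewrite !inE /split_adj eq_sym.
by rewrite unfold_in; case: (c y =P o) => [->|_]; rewrite ?xo ?andbT ?andbF.
Qed.

Lemma deg_split (x : split_graph) : deg x = class_degree (c x).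
Proof.
rewrite /deg -sum1_card; apply: etrans (sum_split_adj x (fun=> 1%N)) _.
by apply: eq_bigr => o _; rewrite natn.
Qed.

End SplitGraph.

Lemma sum_option_bool (M : nmodType) (F : option bool -> M) :
  \sum_o F o = F None + F (Some true) + F (Some false).
Proof.
rewrite (bigD1 None) //= (bigD1 (Some true)) //= (bigD1 (Some false)) //=.
by rewrite big1 ?addr0 ?addrA //; case=> [[]|].
Qed.

Lemma sum_option_bool_nat (F : option bool -> nat) :
  (\sum_o F o = F None + F (Some true) + F (Some false))%N.
Proof. exact: sum_option_bool. Qed.

Lemma class_size_sum (V : finType) (c : V -> option bool) :
  #|V| = (class_size c None + class_size c (Some true) +
          class_size c (Some false))%N.
Proof.
rewrite -sum1_card (partition_big c predT) //= -sum_option_bool_nat.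
by apply: eq_bigr => o _; rewrite sum1_card.
Qed.

Lemma class_bijection (V V' : finType) (c : V -> option bool)
    (c' : V' -> option bool) (y0 : V') :
  class_size c =1 class_size c' ->
  exists2 phi : V -> V', bijective phi & forall x, c' (phi x) = c x.
Proof.
move=> eq_size.
pose F o := enum [pred x | c x == o]; pose F' o := enum [pred y | c' y == o].
(* The vertex of the same rank in the class with the same label; [lt_index] shows that the default
   [y0] of [nth] is not reached. *)
pose phi x := nth y0 (F' (c x)) (index x (F (c x))).
have lt_index x : (index x (F (c x)) < size (F' (c x)))%N.
  by rewrite -cardE -[#|_|]eq_size [class_size _ _]cardE index_mem mem_enum inE.
have phiE x : c' (phi x) = c x.
  by have := mem_nth y0 (lt_index x); rewrite mem_enum inE => /eqP.
exists phi => //; apply: inj_card_bij; last first.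
  by rewrite (class_size_sum c) (class_size_sum c') !eq_size.
move=> x y eq_phi.
have eq_c : c x = c y by rewrite -!phiE eq_phi.
move: eq_phi (lt_index x) (lt_index y); rewrite /phi eq_c => /eqP + ltx lty.
rewrite nth_uniq ?enum_uniq // => /eqP eq_index.
have xF : x \in F (c y) by rewrite mem_enum inE eq_c.
have yF : y \in F (c y) by rewrite mem_enum inE.
by rewrite -(nth_index x xF) eq_index nth_index.
Qed.

(** * Comparison of weighted radii with split graphs *)

Section WeightFunction.
Variables (R : realType) (f : R -> R -> R).
Hypothesis f_sym : forall x y : R, 1 <= x -> 1 <= y -> f x y = f y x.
Hypothesis f_gt0 : forall x y : R, 1 <= x -> 1 <= y -> 0 < f x y.
Hypothesis f_mono : forall x x' y : R, 1 <= x -> x <= x' -> 1 <= y ->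
  f x y <= f x' y.
Hypothesis f_convex : forall s p q y : R, 1 <= s -> 0 < p -> 0 < q -> 1 <= y ->
  f (s + p) y + f (s + q) y <= f (s + p + q) y + f s y.

Lemma f_mono2 (x x' y y' : R) : 1 <= x -> x <= x' -> 1 <= y -> y <= y' ->
  f x y <= f x' y'.
Proof.
move=> x1 xx' y1 yy'; apply: (le_trans (f_mono x1 xx' y1)).
have x1' := le_trans x1 xx'; have y1' := le_trans y1 yy'.
by rewrite f_sym // [leRHS]f_sym //; apply: f_mono.
Qed.

Section Subgraph.
Variables (G : sgraph) (c : G -> option bool).
Hypothesis subG : forall x y : G, adj x y -> split_adj c x y.

(** Adding edges can only raise degrees, and [f] is nondecreasing in both arguments. *)
Lemma weight_split_le (x y : G) :
  weight f x y <= @weight R f (split_graph c) x y.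
Proof.
have [xy|nxy] := boolP (adj x y); last first.
  by rewrite {1}/weight (negPf nxy); apply: weight_ge0.
have degS (z : G) : (deg z <= @deg (split_graph c) z)%N.
  by apply: subset_leq_card; apply/fintype.subsetP => t; apply: subG.
rewrite /weight xy /= subG //; apply: f_mono2; rewrite ?ler1n ?ler_nat //.
  exact: adj_deg xy.
by apply: (@adj_deg _ y x); rewrite adj_sym.
Qed.

(** A test vector for the split graph also serves for [G]. A missing edge makes the row of its
    endpoint [x] strict, since a positive weight drops to 0 there. *)
Lemma radius_split_subgraph_lt (u : G -> R) (rho : R) :
    connected_graph G -> (forall x, 0 < u x) -> 0 < rho ->
    (forall x, \sum_y @weight R f (split_graph c) x y * u y <= rho * u x) ->
    (exists x, \sum_y @weight R f (split_graph c) x y * u y < rho * u x) \/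
      (exists x y, split_adj c x y && ~~ adj x y) ->
  weighted_radius f G < rho.
Proof.
move=> conn u0 rho0 super strict.
have le_row x : \sum_y weight f x y * u y <=
    \sum_y @weight R f (split_graph c) x y * u y.
  by apply: ler_sum => y _; rewrite ler_wpM2r ?weight_split_le // ltW.
apply: (weighted_radius_lt f_sym f_gt0 u0 rho0 conn).
  by move=> x; apply: le_trans (le_row x) (super x).
case: strict => [[x lt_x]|[x [y /andP[xy nxy]]]]; exists x.
  exact: le_lt_trans (le_row x) lt_x.
apply: lt_le_trans (super x).
rewrite (bigD1 y) //= [ltRHS](bigD1 y) //=; apply: ltr_leD.
  rewrite ltr_pM2r // {1}/weight (negPf nxy).
  exact: (@weight_gt0 _ _ f_gt0 (split_graph c)).
by apply: ler_sum => z _; rewrite ler_wpM2r ?weight_split_le // ltW.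
Qed.

End Subgraph.

Section Rows.
Variables (V : finType) (c : V -> option bool) (w : option bool -> R).
Let H := split_graph c.

(** The right-hand side is a row of the quotient matrix of the partition into classes. *)
Lemma split_row (x : V) :
  \sum_y @weight R f H x y * w (c y) =
  \sum_(o | compatible (c x) o) (class_size c o - (o == c x))%:R *
    (f (class_degree c (c x))%:R (class_degree c o)%:R * w o).
Proof.
under [RHS]eq_bigr do rewrite mulr_natl.
rewrite -sum_split_adj [RHS]big_mkcond; apply: eq_bigr => y _.
by rewrite /weight /= !deg_split; case: ifP; rewrite ?mul0r.
Qed.

End Rows.

Section Radius.
Variables (k m : nat).
Hypothesis k_gt0 : (0 < k)%N.

Let D : R := (k + m)%:R.
Let dm : R := (k + m.-1)%:R.

(* The equation for the Perron root of [K_k \/ (K_m \cup K_1)], by elimination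
   in a vector constant on the three classes. For [m = 0] the value of [dm] is
   irrelevant. *)
Definition split_root (rho : R) : Prop :=
  [/\ 0 < rho, m.-1%:R * f dm dm < rho &
      rho = k.-1%:R * f D D + k%:R *
        (m%:R * f D dm ^+ 2 / (rho - m.-1%:R * f dm dm) +
         f D k%:R ^+ 2 / rho)].

Let D_ge1 : 1 <= D. Proof. by rewrite ler1n addn_gt0 k_gt0. Qed.
Let dm_ge1 : 1 <= dm. Proof. by rewrite ler1n addn_gt0 k_gt0. Qed.
Let k_ge1 : 1 <= k%:R :> R. Proof. by rewrite ler1n. Qed.

Lemma split_root_exists : exists rho, split_root rho.
Proof.
have kR : 0 < k%:R :> R by rewrite ltr0n.
have [||||| rho [rho0 Lrho eq_rho]] := @perron_root R (k.-1%:R * f D D)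
    (m.-1%:R * f dm dm) (k%:R * (m%:R * f D dm ^+ 2)) (k%:R * f D k%:R ^+ 2).
- by rewrite mulr_ge0 // ltW // f_gt0.
- by rewrite mulr_ge0 // ltW // f_gt0.
- by rewrite mulr_ge0 // mulr_ge0 // sqr_ge0.
- by apply: mulr_gt0 => //; rewrite exprn_gt0 // f_gt0.
(* For [m = 0], truncation gives [m.-1 = 0], hence [L = 0]; otherwise [alpha > 0]. *)
- case: m => [|m']; first by left; rewrite mul0r.
  by right; apply: mulr_gt0 => //; rewrite mulr_gt0 ?ltr0n // exprn_gt0 // f_gt0.
by exists rho; split=> //; rewrite mulrDr !mulrA in eq_rho *.
Qed.

Variables (rho : R) (V : finType) (c : V -> option bool).
Hypothesis rho_root : split_root rho.
Hypothesis sizeN : class_size c None = k.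
Hypothesis sizeS : (class_size c (Some true) + class_size c (Some false))%N = m.+1.

Let N s := class_size c (Some s).
Let d s : R := (k + (N s).-1)%:R.

(** Normalized to 1 on [None]; on [Some s] the value [w] solves [rho * w = k * f D (d s) + (N s).-1
    * f (d s) (d s) * w]. *)
Definition test_vector (o : option bool) : R :=
  if o is Some s then k%:R * f D (d s) / (rho - (N s).-1%:R * f (d s) (d s))
  else 1.

(** This is [g (N s)]: the part of a row of class [None] that comes from clique [s], divided by
    [k]. *)
Definition contribution s : R :=
  (N s)%:R * f D (d s) ^+ 2 / (rho - (N s).-1%:R * f (d s) (d s)).

Let row (x : V) : R :=
  \sum_y @weight R f (split_graph c) x y * test_vector (c y).

Lemma class_degree_none : class_degree c None = (k + m)%N.
Proof.
rewrite /class_degree big_mkcond sum_option_bool_nat /= sizeN !subn0.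
by rewrite -addnA sizeS subn1 addnS -addSn prednK.
Qed.

Lemma class_degree_some s : class_degree c (Some s) = (k + (N s).-1)%N.
Proof.
rewrite /class_degree big_mkcond sum_option_bool_nat /= sizeN /N.
by case: s => /=; rewrite subn0 subn1 ?addn0.
Qed.

Lemma row_some x s : (N s).-1%:R * f (d s) (d s) < rho -> c x = Some s ->
  row x = rho * test_vector (c x).
Proof.
move=> lt_rho cx; rewrite /row split_row cx class_degree_some.
rewrite big_mkcond sum_option_bool /= sizeN class_degree_none subn0 mulr1.
rewrite !class_degree_some (f_sym _ D_ge1); last first.
  by rewrite ler1n addn_gt0 k_gt0.
have {lt_rho} : rho - (N s).-1%:R * f (d s) (d s) != 0 by rewrite subr_eq0 gt_eqF.
case: s {cx} => /= nz; rewrite ?addr0 subn1 -/(N _) -/(d _) -/D.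
  by field.
by field.
Qed.

Lemma row_none x : c x = None ->
  row x = k.-1%:R * f D D + k%:R * (contribution true + contribution false).
Proof.
move=> cx; rewrite /row split_row cx class_degree_none.
rewrite big_mkcond sum_option_bool /= sizeN class_degree_none !subn0 subn1 mulr1.
rewrite !class_degree_some -/(N _) -/(N _) -/(d _) -/(d _) -/D.
by rewrite /contribution; ring.
Qed.

Lemma test_vector_gt0 o :
    (forall s, o = Some s -> (N s).-1%:R * f (d s) (d s) < rho) ->
  0 < test_vector o.
Proof.
case: o => [s|] lt_rho //=.
rewrite divr_gt0 // ?subr_gt0 ?lt_rho // mulr_gt0 ?ltr0n // f_gt0 //.
by rewrite ler1n addn_gt0 k_gt0.
Qed.

(** For a singleton, [d false = k] and the denominator of its contribution is [rho], so the row of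
    class [None] becomes the equation in [split_root]. *)
Lemma test_vector_eq : N false = 1%N ->
  (forall x, 0 < test_vector (c x)) /\ forall x, row x = rho * test_vector (c x).
Proof.
case: rho_root => rho0 Lrho eq_rho Nf.
have Nt : N true = m by apply: succn_inj; rewrite -sizeS -addn1 -Nf.
have lt_rho s : (N s).-1%:R * f (d s) (d s) < rho.
  by case: s; rewrite /d ?Nt ?Nf // mul0r.
split=> x; first by apply: test_vector_gt0 => s _.
case cx : (c x) => [s|]; first by rewrite -cx (row_some (lt_rho s) cx).
rewrite row_none // mulr1 [RHS]eq_rho /contribution /d Nt Nf addn0.
by rewrite mul1r mul0r subr0.
Qed.

(** The rows of both cliques are equalities by construction; those of class [None] are strict by
    [clique_contribution_lt], and [k > 0] provides one. *)
Lemma test_vector_lt : (1 < N true)%N -> (1 < N false)%N ->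
  [/\ forall x, 0 < test_vector (c x),
      forall x, row x <= rho * test_vector (c x) &
      exists x, row x < rho * test_vector (c x)].
Proof.
case: rho_root => rho0 Lrho eq_rho Nt Nf.
have d1 s : 1 <= d s by rewrite ler1n addn_gt0 k_gt0.
have eq_m : ((N true).-1 + (N false).-1)%N = m.-1.
  by move: sizeS Nt Nf; rewrite /N; lia.
have N_m s : ((N s).-1 <= m.-1)%N.
  by rewrite -eq_m; case: s; rewrite ?leq_addr ?leq_addl.
have d_dm s : d s <= dm by rewrite ler_nat leq_add2l.
have fdm : 0 < f dm dm by apply: f_gt0.
have lt_rho s : (N s).-1%:R * f (d s) (d s) < rho.
  apply: le_lt_trans Lrho; apply: ler_pM => //; rewrite ?ler_nat //.
    by rewrite ltW // f_gt0.
  exact: f_mono2.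
have lt_none : k.-1%:R * f D D + k%:R * (contribution true + contribution false)
    < rho.
  rewrite [ltRHS]eq_rho ltrD2l ltr_pM2l ?ltr0n // /contribution.
  have NE s : (1 < N s)%N -> (N s)%:R = (N s).-1%:R + 1 :> R.
    by move=> Ns; rewrite natr1 prednK // ltnW.
  have m0 : (0 < m)%N by move: sizeS Nt Nf; rewrite /N; lia.
  have mE : m%:R = (N true).-1%:R + (N false).-1%:R + 1 :> R.
    by rewrite -natrD eq_m natr1 prednK.
  have mE' : m.-1%:R = (N true).-1%:R + (N false).-1%:R :> R.
    by rewrite -natrD eq_m.
  rewrite !NE // mE mE'.
  have Dd s : f D (d s) = f (d s) D by apply: f_sym.
  have Ns0 s : (1 < N s)%N -> 0 < (N s).-1%:R :> R.
    by move=> Ns; rewrite ltr0n; case: (N s) Ns => [|[]].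
  have kd s : k%:R <= d s :> R by rewrite ler_nat leq_addr.
  apply: clique_contribution_lt; rewrite ?Ns0 //.
  - exact: f_gt0.
  - by rewrite Dd f_sym //; apply: f_mono.
  - by rewrite Dd f_sym //; apply: f_mono.
  (* Convexity from the base point [k] with increments [(N s).-1]: the other three points are
     [d true], [d false] and [dm]. *)
  - rewrite !Dd [f D dm]f_sym // [f D k%:R]f_sym //.
    rewrite /dm -eq_m /d !natrD addrA.
    by apply: f_convex; rewrite ?Ns0.
  - exact: f_mono2.
  - exact: f_mono2.
  - by rewrite -mE'.
split=> [x|x|]; first by apply: test_vector_gt0 => s _.
  case cx : (c x) => [s|]; first by rewrite -cx (row_some (lt_rho s) cx).
  by rewrite row_none // mulr1 ltW.
have /card_gt0P[x] : (0 < #|[pred x | c x == None]|)%N by rewrite [#|_|]sizeN.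
rewrite inE => /eqP cx; exists x.
by rewrite row_none // cx mulr1.
Qed.

End Radius.

(** Stated through a class function, so that it applies both to the extremal graph and to every
    graph isomorphic to it. *)
Lemma radius_full_split (k m : nat) (rho : R) (G : sgraph) (c : G -> option bool) :
    (0 < k)%N -> split_root k m rho ->
    class_size c None = k -> class_size c (Some true) = m ->
    class_size c (Some false) = 1%N ->
    (forall x y, adj x y = split_adj c x y) ->
  weighted_radius f G = rho.
Proof.
move=> k0 root_rho sN sT sF full.
have [|w0 eq_row] := test_vector_eq k0 root_rho sN _ sF.
  by rewrite sT sF addn1.
have [rho0 _ _] := root_rho.
apply: (weighted_radius_eq f_sym f_gt0 w0 rho0).
  by rewrite (class_size_sum c) sN; case: (k) k0.
have degE (z : G) : deg z = @deg (split_graph c) z.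
  by apply: eq_card => t; rewrite !inE; apply: full.
move=> x; rewrite -eq_row; apply: eq_bigr => y _.
by rewrite /weight /= full !degE.
Qed.

(** If both parts have at least two vertices, the test vector has a strict row. If one is a
    singleton, all rows of the split graph are equalities and the missing edge gives strictness. *)
Lemma radius_split_lt (k m : nat) (rho : R) (G : sgraph) (c : G -> option bool) :
    (0 < k)%N -> split_root k m rho -> connected_graph G ->
    class_size c None = k ->
    (class_size c (Some true) + class_size c (Some false))%N = m.+1 ->
    (forall x y, adj x y -> split_adj c x y) ->
    ((1 < class_size c (Some true)) && (1 < class_size c (Some false)))%N \/
    class_size c (Some false) = 1%N /\ (exists x y, split_adj c x y && ~~ adj x y) ->
  weighted_radius f G < rho.
Proof.
move=> k0 root_rho conn sN sS subG; have [rho0 _ _] := root_rho.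
case=> [/andP[sT sF]|[sF missing]].
  have [w0 super strict] := test_vector_lt k0 root_rho sN sS sT sF.
  by apply: (radius_split_subgraph_lt subG conn w0 rho0 super); left.
have [w0 eq_row] := test_vector_eq k0 root_rho sN sS sF.
apply: (radius_split_subgraph_lt subG conn w0 rho0); last by right.
by move=> x; rewrite -eq_row.
Qed.

End WeightFunction.

(** * The extremal graph as a split graph *)

Section Extremal.
Variables (k m : nat).

Definition extremal_graph : sgraph :=
  graph_join (complete_graph k) (graph_union (complete_graph m) (complete_graph 1)).

Definition extremal_class (x : extremal_graph) : option bool :=
  match x with
  | inl _ => None
  | inr (inl _) => Some true
  | inr (inr _) => Some false
  end.

Lemma extremal_adj x y : adj x y = split_adj extremal_class x y.
Proof.
by case: x y => [x|[x|x]] [y|[y|y]] //=; rewrite /complete_adj /split_adj /= ?andbT ?andbF.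
Qed.

Lemma class_size_extremal o :
  class_size extremal_class o =
  match o with None => k | Some true => m | Some false => 1%N end.
Proof.
have image_class p (h : 'I_p -> extremal_graph) : injective h ->
    (forall x, (extremal_class x == o) = (x \in codom h)) ->
    class_size extremal_class o = p.
  move=> h_inj hE; rewrite -[RHS]card_ord -(card_codom h_inj).
  by apply: eq_card => x; rewrite -hE.
case: o image_class => [[]|] image_class.
- apply: (image_class _ (fun i => inr (inl i))) => [i j []//|x].
  by apply/eqP/codomP => [|[i ->] //]; case: x => [x|[x|x]] //= _; exists x.
- apply: (image_class _ (fun i => inr (inr i))) => [i j []//|x].
  by apply/eqP/codomP => [|[i ->] //]; case: x => [x|[x|x]] //= _; exists x.
apply: (image_class _ (fun i => inl i)) => [i j []//|x].
by apply/eqP/codomP => [|[i ->] //]; case: x => [x|[x|x]] //= _; exists x.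
Qed.

(** Adjacency is determined by classes and equality of vertices, so a class-preserving bijection is
    an isomorphism. *)
Lemma full_split_iso (G : sgraph) (c : G -> option bool) :
    class_size c None = k -> class_size c (Some true) = m ->
    class_size c (Some false) = 1%N ->
    (forall x y, adj x y = split_adj c x y) ->
  graph_iso G extremal_graph.
Proof.
move=> sN sT sF full.
have [|phi bij phiE] := @class_bijection _ _ c extremal_class (inr (inr ord0)).
  by move=> [[]|]; rewrite class_size_extremal.
exists phi; split=> // x y.
rewrite extremal_adj full /split_adj !phiE; congr (~~ _ && _).
exact: (inj_eq (bij_inj bij)).
Qed.

Lemma iso_full_split (G : sgraph) : graph_iso G extremal_graph ->
  exists2 c : G -> option bool,
    class_size c =1 class_size extremal_class &
    forall x y, adj x y = split_adj c x y.
Proof.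
case=> phi [bij adjE]; exists (extremal_class \o phi).
  move=> o; rewrite /class_size.
  rewrite -(@on_card_preimset _ _ phi [pred y | extremal_class y == o]).
    by apply: eq_card => x; rewrite !inE.
  exact: onW_bij.
move=> x y; rewrite -adjE extremal_adj /split_adj.
by rewrite (inj_eq (bij_inj bij)).
Qed.

End Extremal.

(** * Splitting a graph along a vertex cut *)

Section VertexCut.
Variables (G : sgraph) (W : {set G}).

(* The second alternative covers the case of a single remaining vertex, with
   [Some true] empty; the two parts are swapped when the first is a singleton. *)
Lemma vertex_cut_class : vertex_cut_set W ->
  exists c : G -> option bool,
    [/\ class_size c None = #|W|,
        forall x y, adj x y -> split_adj c x y &
        (1 < class_size c (Some true))%N && (1 < class_size c (Some false))%N
        \/ class_size c (Some false) = 1%N].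
Proof.
have adj_neq (x y : G) : adj x y -> x != y.
  by apply: contraTneq => ->; rewrite adj_irrefl.
case=> [disconn|card1]; last first.
  pose c (x : G) := if x \in W then None else Some false.
  exists c; split.
  - apply: eq_card => x; rewrite !inE /c.
    by case: (x \in W).
  - move=> x y /adj_neq xy; rewrite /split_adj xy /c.
    by case: (x \in W) (y \in W) => [] [].
  right; rewrite -card1 card_sub; apply: eq_card => x; rewrite !inE /c.
  by case: (x \in W).
have [x [y nxy]] : exists x y : delete_vertices W,
    ~~ connect (@adj (delete_vertices W)) x y.
  apply: contra_notP disconn => nex x y; apply/negPn/negP => nxy.
  by apply: nex; exists x, y.
(* Vertices of [W] get [None]; the others are labelled by membership in the component of [x], and
   [b] exchanges the two labels. *)
pose c0 (b : bool) (z : G) : option bool :=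
  omap (fun u : delete_vertices W => connect (@adj (delete_vertices W)) x u (+) b)
    (insub z).
have c0E b (u : delete_vertices W) :
    c0 b (val u) = Some (connect (@adj (delete_vertices W)) x u (+) b).
  by rewrite /c0 valK.
have c0W b (z : G) : z \in W -> c0 b z = None.
  by move=> zW; rewrite /c0 insubF ?zW.
have sN b : class_size (c0 b) None = #|W|.
  apply: eq_card => z; rewrite !inE; have [/c0W->//|zW] := boolP (z \in W).
  by rewrite (c0E b (Sub z zW)).
have sub b z z' : adj z z' -> split_adj (c0 b) z z'.
  move=> zz'; rewrite /split_adj adj_neq //=.
  have [/c0W->//|zW] := boolP (z \in W).
  have [/c0W->|z'W] := boolP (z' \in W); first by case: (c0 b z).
  rewrite (c0E b (Sub z zW)) (c0E b (Sub z' z'W)) /=.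
  (* Neighbours outside [W] lie in the same component of the remaining graph. *)
  apply/eqP; congr (_ (+) _).
  have adj_u : @adj (delete_vertices W) (Sub z zW) (Sub z' z'W) by [].
  apply/idP/idP => xu; apply: connect_trans xu (connect1 _) => //.
  by rewrite delete_adj_sym.
have size_gt0 s : (0 < class_size (c0 false) (Some s))%N.
  apply/card_gt0P; case: s; [exists (val x)|exists (val y)].
    by rewrite inE c0E connect0.
  by rewrite inE c0E (negPf nxy).
have swap s : class_size (c0 true) (Some s) = class_size (c0 false) (Some (~~ s)).
  apply: eq_card => z; rewrite !inE /c0.
  by case: insub => [u|] //=; case: (connect _ _ u); case: s.
(* If the component of [x] is a single vertex, the labels are exchanged to make it the class
   [Some false]. *)
have [gtT|leT] := ltnP 1 (class_size (c0 false) (Some true)); last first.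
  exists (c0 true); split; [exact: sN|exact: sub|right].
  by rewrite swap; apply/eqP; rewrite eqn_leq leT size_gt0.
exists (c0 false); split; [exact: sN|exact: sub|rewrite gtT /=].
have [|leF] := ltnP 1 (class_size (c0 false) (Some false)); first by left.
by right; apply/eqP; rewrite eqn_leq leF size_gt0.
Qed.

End VertexCut.

(** * From the derivative conditions to the extremal inequality *)

Lemma property_Pstar_convex (R : realType) (f : R -> R -> R) :
  property_Pstar f ->
  [/\ forall x y, 1 <= x -> 1 <= y -> 0 < f x y,
      forall x x' y, 1 <= x -> x <= x' -> 1 <= y -> f x y <= f x' y &
      forall s p q y, 1 <= s -> 0 < p -> 0 < q -> 1 <= y ->
        f (s + p) y + f (s + q) y <= f (s + p + q) y + f s y].
Proof.
case=> f_gt0 [fx [fxx df]] _; split=> //.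
  move=> x x' y x1 xx' y1.
  by apply: (derivative_ge1_ge0_le x1 xx' (g := f ^~ y) (g' := fx ^~ y)) => t t1;
    have [] := df t y t1 y1.
move=> s p q y s1 p0 q0 y1.
by apply: (derivative_ge1_convex s1 p0 q0 (g := f ^~ y) (g' := fx ^~ y)
    (g'' := fxx ^~ y)) => t t1; have [] := df t y t1 y1.
Qed.

Theorem theorem2p5 (R : realType) (f : R -> R -> R)
  (f_sym : forall x y : R, 1 <= x -> 1 <= y -> f x y = f y x)
  (f_Pstar : property_Pstar f)
  (n k : nat) (k_ge1 : (1 <= k)%N) (k_le : (k <= n - 1)%N)
  (G : sgraph) (G_in_V : connected_with_cut n k G) :
  let E := graph_join (complete_graph k)
             (graph_union (complete_graph (n - 1 - k)) (complete_graph 1)) in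
  weighted_radius f G <= weighted_radius f E /\
  (weighted_radius f G = weighted_radius f E <-> graph_iso G E).
Proof.
set m := (n - 1 - k)%N; rewrite -[graph_join _ _]/(extremal_graph k m) => E.
have [f_gt0 f_mono f_convex] := property_Pstar_convex f_Pstar.
have [rho root_rho] := split_root_exists f_gt0 m k_ge1.
have full_radius := radius_full_split f_sym f_gt0 k_ge1 root_rho.
have -> : weighted_radius f E = rho.
  by apply: (full_radius _ (@extremal_class k m));
    rewrite ?class_size_extremal //; apply: extremal_adj.
(* A graph isomorphic to [E] has radius [rho] and any other a strictly smaller one, which settles
   both claims. *)
have [iso|niso] := pselect (graph_iso G E).
  have [c size_c full] := iso_full_split iso.
  by rewrite (full_radius _ c) ?size_c ?class_size_extremal.
suff lt_rho : weighted_radius f G < rho.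
  split; first exact: ltW.
  by split=> // eq_rho; rewrite eq_rho ltxx in lt_rho.
case: G_in_V => conn cardG [W /vertex_cut_class[c [cN cS c_sizes]] cardW].
rewrite cardW in cN.
have sumS : (class_size c (Some true) + class_size c (Some false))%N = m.+1.
  (* [k <= n - 1] makes the truncated subtractions exact, so that [m + 1 = n - k]. *)
  by have := class_size_sum c; rewrite cardG cN /m; lia.
apply: (radius_split_lt f_sym f_gt0 f_mono f_convex k_ge1 root_rho conn cN sumS cS).
case: c_sizes => [->|cF]; [by left|right; split=> //].
(* If no edge were missing, [G] would be the full split graph with parts of sizes [m] and 1, hence
   isomorphic to [E]. *)
apply: contra_notP niso => no_missing.
apply: (full_split_iso cN _ cF) => [|x y].
  by apply: succn_inj; rewrite -sumS cF addn1.
apply/idP/idP => [/cS//|xy]; apply/negPn/negP => nxy; apply: no_missing.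
by exists x, y; rewrite xy.
Qed.
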